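(* Let $q=p^m$ where $p$ is a prime with $p>5$ and $m\ge 1$, and suppose $q\equiv 1 \pmod 6$ and $q\notin\{7,19,313\}$. Let $f(x)=x^{q+2}$ on $\mathbb{F}_{q^2}$. Then the boomerang uniformity of $f$ is $\beta_f=5$.
   Context: For a function $f:\mathbb{F}_{Q}\to\mathbb{F}_{Q}$ and $a,b\in\mathbb{F}_{Q}$, $\beta_f(a,b)$ denotes the number of pairs $(x,y)\in\mathbb{F}_{Q}^2$ satisfying $f(x)-f(y)=b$ and $f(x+a)-f(y+a)=b$. The boomerang uniformity is $\beta_f=\max_{a,b\in\mathbb{F}_Q^*}\beta_f(a,b)$. *)

(* Defs.v *)
From HB Require Import structures.
From mathcomp Require Import all_boot all_order all_algebra all_field.
Set Implicit Arguments. Unset Strict Implicit. Unset Printing Implicit Defensive.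
Import GRing.Theory.
Local Open Scope ring_scope.

Definition boomerang_count (F : finFieldType) (f : F -> F) (a b : F) : nat :=
  #|[set xy : F * F | (f xy.1 - f xy.2 == b)
                      && (f (xy.1 + a) - f (xy.2 + a) == b)]|.

Definition boomerang_uniformity (F : finFieldType) (f : F -> F) : nat :=
  \max_(ab : F * F | (ab.1 != 0) && (ab.2 != 0)) boomerang_count f ab.1 ab.2.

(* Main.v *)
Require Import Defs.
From Stdlib Require Import BinNat Nnat.
From HB Require Import structures.
From mathcomp Require Import all_boot all_order all_algebra all_field.
From mathcomp Require Import zify ring.
Set Implicit Arguments. Unset Strict Implicit. Unset Printing Implicit Defensive.
Import GRing.Theory.
Local Open Scope ring_scope.

(* Write x' = x^q, so that f x = x^2 x'. For a nonzero, f(x + a) - f(x) is, up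
   to an affine change of variable, the map u |-> u^2 + 2 u u', which is
   two-to-one with fibres {u, -u} because -3 is a square in F_q. Hence the pairs
   counted by the boomerang entry at (a, b) are x = a (w - 1) / 2,
   y = - a (w + 1) / 2, where w^2 w' + 2 w + w' = c with c = 4 b / f(a).

   Upper bound: with N = w w' the last equation says (w + w') (N + 3) = c + c'
   and (w - w') (N + 1) = c - c'. If neither right-hand side vanishes, N
   determines w and is a root of a quintic; otherwise w itself is a root of the
   product of a cubic and a quadratic polynomial.

   Lower bound: take c' = - c. The solutions with w' = - w are the roots of
   w - w^3 = c, solved by Cardano's formulas; those with N = -3 are
   - c / 2 + rho and - c / 2 - rho with rho^2 = c^2 / 4 - 3. There are five of
   them as soon as, with q = 6 n + 1, some v <> -1 satisfies v^n = -1 and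
   v^2 + 322 v + 1 is a nonsquare of F_q.

   Such a v exists by a Stepanov argument. Let k = X^2 + 322 X + 1,
   g = k^(3 n), P = X^n + 1. Then k g^2 = k^q = k(X^q) and
   X^q = X (1 - P)^6, so modulo P^7 one can write k(X^q) / k as a polynomial in
   P over F(X); if g = 1 at almost all roots of P, then there g agrees to order
   7 with W / k^6, where W is the Taylor polynomial of degree 6 in P of
   k^6 sqrt(k(X^q) / k). The degree of k^6 g - W is at most 6 n + 12, which is
   too small for n > 33. The remaining q are settled by explicit witnesses. *)

(** * Powers in finite fields *)

(** Since [x ^+ e = 1], ['X^d - x] divides [('X^d)^e - 1], hence ['X^#|F| - 'X], which splits over
    [F] into distinct linear factors. *)
Lemma power_roots (F : finFieldType) (d e : nat) (x : F) :
    (d * e)%N = #|F|.-1 -> x ^+ e = 1 ->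
  exists rs : seq F, [/\ uniq rs, size rs = d & all (fun y => y ^+ d == x) rs].
Proof.
move=> de xe; have cF : (1 < #|F|)%N by apply: finNzRing_gt1.
have d0 : (0 < d)%N by case: d de => // ; lia.
have : 'X^d - x%:P %| \prod_(y <- enum F) ('X - y%:P).
  rewrite big_enum /= -finField_genPoly -[#|F|]prednK ?(ltnW cF) // -de.
  rewrite exprS exprM -[X in _ * _ - X]mulr1 -mulrBr dvdp_mull //.
  by rewrite -[1]polyC1 -xe rmorphXn /= subrXX dvdp_mulr.
case/dvdp_prod_XsubC => m; rewrite eqp_monic ?monicXnsubC ?monic_prod_XsubC //.
move/eqP=> Em; exists (mask m (enum F)); split.
- exact/mask_uniq/enum_uniq.
- by have := congr1 (fun p : {poly F} => size p) Em; rewrite size_XnsubC // size_prod_XsubC => -[].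
- apply/allP=> y ys; have : root ('X^d - x%:P) y by rewrite Em root_prod_XsubC.
  by rewrite rootE !hornerE subr_eq0.
Qed.

Lemma power_root (F : finFieldType) (d e : nat) (x : F) :
  (d * e)%N = #|F|.-1 -> x ^+ e = 1 -> exists y, y ^+ d = x.
Proof.
move=> de xe; have [[|y rs] [_ ds /=]] := power_roots de xe; last first.
  by case/andP=> /eqP ? _; exists y.
by have := finNzRing_gt1 F; rewrite -ltn_predRL -de -ds.
Qed.

(* 1024 times the Taylor polynomial of order 6 of sqrt (1 + x), homogenised. *)
Definition sqrt_taylor (R : pzRingType) (k x : R) : R :=
  1024 * k ^+ 6 + 512 * k ^+ 5 * x - 128 * k ^+ 4 * x ^+ 2
  + 64 * k ^+ 3 * x ^+ 3 - 40 * k ^+ 2 * x ^+ 4 + 28 * k * x ^+ 5 - 21 * x ^+ 6.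

(** The form truncates 1024 k^6 sqrt(1 + x/k), whose square is 1024^2 k^11 (k + x); truncation only
    disturbs orders 7 and above, collected in [c]. *)
Lemma sqrt_taylor_sqr (R : comPzRingType) (k x : R) :
  exists c, sqrt_taylor k x ^+ 2 = 1024 ^+ 2 * k ^+ 11 * (k + x) + c * x ^+ 7.
Proof.
exists (- (33 * 1024) * k ^+ 5 + 32 * 330 * k ^+ 4 * x - 64 * 77 * k ^+ 3 * x ^+ 2
  + 32 * 77 * k ^+ 2 * x ^+ 3 - 24 * 49 * k * x ^+ 4 + 21 * 21 * x ^+ 5).
rewrite /sqrt_taylor; ring.
Qed.

Lemma sqrt_taylor_modl (R : comPzRingType) (k x : R) :
  exists c, sqrt_taylor k x = 1024 * k ^+ 6 + c * x.
Proof.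
exists (512 * k ^+ 5 - 128 * k ^+ 4 * x + 64 * k ^+ 3 * x ^+ 2 - 40 * k ^+ 2 * x ^+ 3
  + 28 * k * x ^+ 4 - 21 * x ^+ 5).
rewrite /sqrt_taylor; ring.
Qed.

(** * Bounds on the inner degree of polynomials over polynomials *)

Definition coef_deg (R : nzRingType) (d : nat) (W : {poly {poly R}}) : Prop :=
  forall i, (size (W`_i)%R <= d.+1)%N.

Arguments coef_deg {R} d%_N W.

Section CoefDeg.
Variable R : nzRingType.
Implicit Types W U : {poly {poly R}}.

Lemma coef_degD d W U : coef_deg d W -> coef_deg d U -> coef_deg d (W + U).
Proof.
move=> dW dU i; rewrite coefD; apply: leq_trans (size_polyD _ _) _.
by rewrite geq_max dW dU.
Qed.

Lemma coef_degN d W : coef_deg d W -> coef_deg d (- W).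
Proof. by move=> dW i; rewrite coefN size_polyN. Qed.

Lemma coef_degM d e W U : coef_deg d W -> coef_deg e U -> coef_deg (d + e) (W * U).
Proof.
move=> dW dU i; rewrite coefM; apply: leq_trans (size_sum _ _ _) _.
apply/bigmax_leqP=> j _; apply: leq_trans (size_polyMleq _ _) _.
by have := dW j; have := dU (i - j)%N; lia.
Qed.

Lemma coef_degX d e W : coef_deg d W -> coef_deg (d * e) (W ^+ e).
Proof.
move=> dW; elim: e => [|e IH]; last by rewrite exprS mulnS; apply: coef_degM.
by rewrite muln0 expr0 => i; rewrite coef1; case: eqP; rewrite ?size_poly1 ?size_poly0.
Qed.

Lemma coef_degC d (c : {poly R}) : (size c <= d.+1)%N -> coef_deg d c%:P.
Proof. by move=> dc i; rewrite coefC; case: eqP; rewrite ?size_poly0. Qed.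

Lemma coef_deg_nat m : coef_deg 0 (m%:R : {poly {poly R}}).
Proof. by rewrite -!polyC_natr; apply: coef_degC; rewrite size_polyC_leq1. Qed.

Lemma coef_degXvar : coef_deg 0 ('X : {poly {poly R}}).
Proof. by move=> i; rewrite coefX; case: eqP; rewrite ?size_poly1 ?size_poly0. Qed.

Lemma coef_deg_term d m i j e W U : coef_deg d W -> coef_deg d U -> (d * (i + j))%N = e ->
  coef_deg e (m%:R * W ^+ i * U ^+ j).
Proof.
move=> dW dU <-; rewrite mulnDr; apply: coef_degM; last exact: coef_degX.
exact: (coef_degM (d := 0%N) (coef_deg_nat _) (coef_degX _ _)).
Qed.

Lemma coef_deg_take d m W : coef_deg d W -> coef_deg d (take_poly m W).
Proof. by move=> dW i; rewrite coef_take_poly; case: ifP; rewrite ?size_poly0. Qed.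

Lemma sqrt_taylor_deg d W U :
  coef_deg d W -> coef_deg d U -> coef_deg (d * 6) (sqrt_taylor W U).
Proof.
move=> dW dU; have dterm m i j : (i + j = 6)%N -> coef_deg (d * 6) (m%:R * W ^+ i * U ^+ j).
  by move=> ij; apply: coef_deg_term; rewrite ?ij.
have d1 := dterm 1024 6%N 0%N erefl; rewrite mulr1 in d1.
have d2 := dterm 28 1%N 5%N erefl; have d3 := dterm 21 0%N 6%N erefl; rewrite mulr1 in d3.
rewrite /sqrt_taylor.
apply: coef_degD (coef_degN d3); apply: coef_degD d2.
apply: coef_degD (coef_degN (dterm 40 2%N 4%N erefl)).
apply: coef_degD (dterm 64 3%N 3%N erefl).
apply: coef_degD (coef_degN (dterm 128 4%N 2%N erefl)).
exact: coef_degD d1 (dterm 512 5%N 1%N erefl).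
Qed.

End CoefDeg.

Lemma horner_natr (R : nzRingType) (m : nat) (x : R) : (m%:R : {poly R}).[x] = m%:R.
Proof. by rewrite -polyC_natr hornerC. Qed.

Lemma natr_pchar_exp (R : comNzRingType) (n m : nat) :
  [pchar R].-nat n -> (m%:R : R) ^+ n = m%:R.
Proof.
move=> chn; elim: m => [|m IH]; first by rewrite expr0n; case: n chn.
by rewrite -natr1 exprDn_pchar // IH expr1n.
Qed.

(* The constant 322 is the one for which the identity
   [c ^+ 2 / 4 - 3 = - kpoly (z ^+ 6) / (108 * z ^+ 6)] holds when
   [c = (z ^+ 3 - z ^- 3) / (3 * th)] and [th ^+ 2 = -3]. *)
Definition kpoly (R : comPzRingType) (x : R) : R := x ^+ 2 + 322 * x + 1.

Lemma horner_kpoly (R : comNzRingType) (x : R) : (kpoly 'X).[x] = kpoly x.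
Proof. by rewrite /kpoly !hornerD hornerXn hornerM hornerX horner_natr (hornerC 1). Qed.

(* If [kpoly] were a square up to the scalar [c ^+ 2], its discriminant
   [322 ^+ 2 - 4 = 2 ^+ 8 * 3 ^+ 4 * 5] would vanish. *)
Lemma kpoly_sqr_degenerate (R : comPzRingType) (a b c : R) (s : R -> R) :
    c ^+ 2 * kpoly 0 = s 0 ^+ 2 -> c ^+ 2 * kpoly 1 = s 1 ^+ 2 ->
    c ^+ 2 * kpoly (-1) = s (-1) ^+ 2 -> (forall x, s x = a + b * x) ->
  c ^+ 4 * (2 ^+ 6 * 30 ^+ 4) = 0.
Proof.
move=> + + + sE; rewrite !sE /kpoly.
set k0 := c ^+ 2 * _; set k1 := c ^+ 2 * _; set kN := c ^+ 2 * _ => E0 E1 EN.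
(* Vanishing of the discriminant, read off from values at 0, 1, -1: for [a + b * x] it says (4ab)^2
   = 8 a^2 (2 b^2). *)
have E : (k1 - kN) ^+ 2 = 8 * k0 * (k1 + kN - 2 * k0) by rewrite E0 E1 EN; ring.
(* Up to [c ^+ 4], the difference is 644^2 - 16 = 2^10 * 3^4 * 5; the factor 125 turns it into 2^6 *
   30^4. *)
transitivity (125 * ((k1 - kN) ^+ 2 - 8 * k0 * (k1 + kN - 2 * k0))).
  by rewrite /k0 /k1 /kN; ring.
by rewrite E subrr mulr0.
Qed.

Lemma kpoly_pchar_exp (R : comNzRingType) (n : nat) (x : R) :
  [pchar R].-nat n -> kpoly x ^+ n = kpoly (x ^+ n).
Proof.
move=> chn; rewrite /kpoly !exprDn_pchar // (exprMn n 322 x).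
by rewrite natr_pchar_exp // expr1n exprAC.
Qed.

Lemma prod_XsubC_exp_dvd (R : fieldType) (m : nat) (rs : seq R) (p : {poly R}) :
  uniq rs -> (forall v, v \in rs -> ('X - v%:P) ^+ m %| p) ->
  (\prod_(v <- rs) ('X - v%:P)) ^+ m %| p.
Proof.
elim: rs => [|v rs IH] /=; first by rewrite big_nil expr1n dvd1p.
case/andP=> vrs urs dv; rewrite big_cons exprMn Gauss_dvdp.
  by rewrite dv ?mem_head // IH // => u urs'; rewrite dv // inE urs' orbT.
by rewrite coprimep_expl // coprimep_expr // coprimep_sym coprimep_XsubC root_prod_XsubC.
Qed.

(** * The Stepanov argument *)

Section Stepanov.

Variables (F : finFieldType) (q n : nat).
Hypotheses (chq : [pchar F].-nat q) (qn : q = (6 * n).+1) (cF : #|F| = (q * q)%N).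
Hypothesis F30 : (30 : F) != 0.

Let n_dvd : (n * (12 * (3 * n).+1))%N = #|F|.-1.
Proof. by rewrite cF qn; clear; lia. Qed.

Let k : {poly F} := kpoly 'X.
Let g : {poly F} := k ^+ (3 * n).
Let P : {poly F} := 'X^n + 1.

Let size_k : size k = 3%N.
Proof.
have -> : k = 'X^2 + (322%:P * 'X + 1%:P) by rewrite /k /kpoly polyC1 polyC_natr addrA.
rewrite size_polyDl size_polyXn // size_MXaddC; case: ifP => // _.
by rewrite ltnS ltnS size_polyC_leq1.
Qed.

(* With [E] the outer variable, [DE = (1 - E) ^+ 6 - 1] and
   [N = kpoly ('X * (1 - E) ^+ 6) - kpoly 'X]; [E] is later evaluated at [P]. *)
Let DE : {poly {poly F}} := 'X * (- 6 + 15 * 'X - 20 * 'X^2 + 15 * 'X^3 - 6 * 'X^4 + 'X^5).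
Let N : {poly {poly F}} := DE * (322 * 'X + 2 * 'X^2)%:P + DE ^+ 2 * ('X^2)%:P.
(** As [N] is divisible by the outer variable, cutting at order 7 keeps the precision of the Taylor
    form and bounds the degree in [P] by 6. *)
Let W : {poly {poly F}} := take_poly 7 (sqrt_taylor k%:P N).

Let X_dvd_N : exists N0, N = 'X * N0.
Proof. by eexists; rewrite /N /DE -mulrA expr2 -!mulrA -mulrDr. Qed.

Let W_at0 : W.[0] = 1024 * k ^+ 6.
Proof.
have [c Ec] := sqrt_taylor_modl k%:P N.
have [N0 EN] := X_dvd_N.
rewrite horner_coef0 coef_take_poly Ec EN (mulrCA c 'X N0) coefD coefXM addr0.
have -> : 1024 * k%:P ^+ 6 = (1024 * k ^+ 6)%:P by rewrite polyCM polyC_exp polyC_natr.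
by rewrite coefC.
Qed.

Let W_sqr : exists C, W ^+ 2 = 1024 ^+ 2 * k%:P ^+ 11 * (k%:P + N) + C * 'X^7.
Proof.
have [c Ec] := sqrt_taylor_sqr k%:P N.
have [N0 EN] := X_dvd_N.
have := poly_take_drop 7 (sqrt_taylor k%:P N); rewrite -/W.
set S := sqrt_taylor _ _ in Ec *; set dr := drop_poly _ _ => EW.
have -> : W = S - dr * 'X^7 by rewrite -EW addrK.
exists (c * N0 ^+ 7 - 2 * S * dr + dr ^+ 2 * 'X^7).
transitivity (S ^+ 2 + (dr ^+ 2 * 'X^7 - 2 * S * dr) * 'X^7); first by ring.
by rewrite Ec {2}EN (exprMn 7 'X N0); ring.
Qed.

Let X_pow_q : 'X^q = 'X * 'X^n ^+ 6 :> {poly F}.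
Proof. by rewrite qn exprS mulnC exprM. Qed.

Let k_g2 : k * g ^+ 2 = kpoly 'X^q.
Proof.
rewrite /k -kpoly_pchar_exp; last by rewrite (eq_pnat _ (pchar_poly F)).
by rewrite /g -exprM -exprS; congr (_ ^+ _); lia.
Qed.

Let N_horner : k + N.[P] = kpoly 'X^q.
Proof.
have -> : N.[P] = DE.[P] * (322 * 'X + 2 * 'X^2) + DE.[P] ^+ 2 * 'X^2.
  by rewrite hornerD !hornerM !hornerC expr2.
have -> : DE.[P] = P * (- 6 + 15 * P - 20 * P ^+ 2 + 15 * P ^+ 3 - 6 * P ^+ 4 + P ^+ 5).
  by rewrite !(horner_natr, hornerM, hornerXn, hornerX, hornerN, hornerD).
rewrite X_pow_q /k /kpoly /P.
ring.
Qed.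

(** A difference of squares: by [k_g2] and [N_horner], both squares equal 1024^2 k^11 k(X^q) modulo
    [P ^+ 7]. *)
Let XY_dvd : P ^+ 7 %| (1024 * k ^+ 6 * g - W.[P]) * (1024 * k ^+ 6 * g + W.[P]).
Proof.
have [C EC] := W_sqr.
have EP : W.[P] ^+ 2 = 1024 ^+ 2 * k ^+ 11 * (k + N.[P]) + C.[P] * P ^+ 7.
  rewrite -horner_exp EC hornerD (hornerM C) (hornerM _ (k%:P + N)) (hornerM _ (k%:P ^+ 11)).
  by rewrite !horner_exp horner_natr (hornerD k%:P) !hornerC hornerX.
rewrite N_horner -k_g2 in EP.
have -> : (1024 * k ^+ 6 * g - W.[P]) * (1024 * k ^+ 6 * g + W.[P]) = - C.[P] * P ^+ 7.
  apply: (@addrI _ (W.[P] ^+ 2)); rewrite {2}EP; ring.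
by rewrite dvdp_mull.
Qed.

(** [DE] has constant coefficients, so [N], like [k], has inner degree at most 2, and the Taylor
    form is homogeneous of degree 6. *)
Let W_deg : coef_deg 12 W.
Proof.
have dX i : coef_deg 0 ('X^i : {poly {poly F}}) := coef_degX i (@coef_degXvar F).
have dnX m i : coef_deg 0 (m%:R * 'X^i : {poly {poly F}}).
  by apply: (coef_degM (d := 0%N) (e := 0%N)); [exact: coef_deg_nat | exact: dX].
have dDE : coef_deg 0 DE.
  apply: (coef_degM (d := 0%N) (e := 0%N) (coef_degXvar _)).
  apply: coef_degD (dX 5%N); apply: coef_degD (coef_degN (dnX 6%N 4%N)).
  apply: coef_degD (dnX 15%N 3%N); apply: coef_degD (coef_degN (dnX 20%N 2%N)).
  by apply: coef_degD (dnX 15%N 1%N); apply: coef_degN; apply: coef_deg_nat.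
apply/coef_deg_take/(sqrt_taylor_deg (d := 2%N)).
  by apply: coef_degC; rewrite size_k.
apply: coef_degD.
  apply: (coef_degM (d := 0%N) (e := 2%N) dDE); apply: coef_degC.
  apply: leq_trans (size_polyD _ _) _; rewrite geq_max.
  by rewrite -!polyC_natr !mul_polyC !(leq_trans (size_scale_leq _ _)) ?size_polyX ?size_polyXn.
apply: (coef_degM (d := 0%N) (e := 2%N) (coef_degX 2%N dDE)).
by apply: coef_degC; rewrite size_polyXn.
Qed.

Let size_WP : (size W.[P] <= 13 + 6 * n)%N.
Proof.
rewrite (horner_coef_wide _ (size_take_poly _ _)); apply: leq_trans (size_sum _ _ _) _.
apply/bigmax_leqP=> i _; apply: leq_trans (size_polyMleq _ _) _.
have sP : (size P <= n.+1)%N.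
  by apply: leq_trans (size_polyD _ _) _; rewrite size_polyXn size_poly1 geq_max leqnn.
have := size_poly_exp_leq P i; have := W_deg i.
have : ((size P).-1 * i <= n * 6)%N by apply: leq_mul; have := ltn_ord i; lia.
rewrite -/W; move: (size (W`_i)%R) (size (P ^+ i)) ((size P).-1 * i)%N => a b c; lia.
Qed.

Let size_W1 : (size W.[1] <= 13)%N.
Proof.
rewrite (horner_coef_wide _ (size_take_poly _ _)); apply: leq_trans (size_sum _ _ _) _.
by apply/bigmax_leqP=> i _; rewrite expr1n mulr1 W_deg.
Qed.

Hypothesis n33 : (33 < n)%N.

Let F2 : (2 : F) != 0.
Proof. by apply: contraNneq F30 => F2; rewrite (natrM _ 2 15) F2 mul0r. Qed.

Let F1024 : (1024 : F) != 0.
Proof. by rewrite (natrX _ 2 10) expf_neq0. Qed.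

Let P1024 : (1024 : {poly F}) != 0.
Proof. by rewrite -polyC_natr polyC_eq0. Qed.

Let k_neq0 : k != 0.
Proof. by rewrite -size_poly_gt0 size_k. Qed.

Let k_not_sqr (s : {poly F}) : s ^+ 2 != 1024 ^+ 2 * k.
Proof.
apply/eqP=> Es; have ss : size s = 2%N.
  have := congr1 (fun t : {poly F} => size t) Es.
  rewrite -polyC_natr -polyC_exp mul_polyC size_scale ?expf_neq0 // size_k.
  have s0 : s != 0.
    apply: contra_eqN Es => /eqP->; rewrite expr0n eq_sym mulf_eq0 (negPf k_neq0).
    by rewrite expf_eq0 (negPf P1024).
  by rewrite expr2 size_mul //; move: (size s) => a; clear; lia.
have s_at x : s.[x] = s`_0 + s`_1 * x.
  by rewrite horner_coef ss !big_ord_recl big_ord0 /= expr0 mulr1 addr0 expr1.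
have sq_at x : s.[x] ^+ 2 = 1024 ^+ 2 * kpoly x.
  by rewrite -horner_exp Es hornerM horner_exp horner_natr horner_kpoly.
have /eqP := kpoly_sqr_degenerate (esym (sq_at 0)) (esym (sq_at 1)) (esym (sq_at (-1))) s_at.
apply/negP; apply: mulf_neq0 (expf_neq0 4 F1024) _.
exact: mulf_neq0 (expf_neq0 6 F2) (expf_neq0 4 F30).
Qed.

(** If the difference vanished, squaring and reducing modulo ['X^n], where [P] is 1 and k(X^q) is 1,
    would make 1024^2 k^11 and [W.[1] ^+ 2] congruent. Their degrees are at most 24, below [n], so
    they would be equal; cancelling [k ^+ 10] would make 1024^2 k a square. *)
Let X_neq0 : 1024 * k ^+ 6 * g - W.[P] != 0.
Proof.
apply/eqP=> /subr0_eq EX.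
have EX2 : 1024 ^+ 2 * k ^+ 11 * kpoly 'X^q = W.[P] ^+ 2 by rewrite -EX -k_g2; ring.
have dW : 'X^n %| W.[P] - W.[1].
  have : root (W - W.[1]%:P) 1 by rewrite rootE hornerD hornerN hornerC subrr.
  case/factor_theorem => c Ec; have -> : W.[P] - W.[1] = c.[P] * 'X^n.
    have -> : W.[P] - W.[1] = (W - W.[1]%:P).[P] by rewrite hornerD hornerN hornerC.
    by rewrite Ec hornerM hornerXsubC /P addrK.
  exact: dvdp_mull.
have dk : 'X^n %| 1024 ^+ 2 * k ^+ 11 - W.[1] ^+ 2.
  have -> : 1024 ^+ 2 * k ^+ 11 - W.[1] ^+ 2 =
     (W.[P] - W.[1]) * (W.[P] + W.[1]) - 1024 ^+ 2 * k ^+ 11 * (kpoly 'X^q - 1).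
    by rewrite mulrBr EX2; ring.
  apply: dvdp_sub; first exact: dvdp_mulr.
  apply: dvdp_mull.
  have -> : kpoly 'X^q - 1 = ('X^q + 322) * 'X^q :> {poly F} by rewrite /kpoly; ring.
  by rewrite dvdp_mull // dvdp_exp2l // qn leqW // leq_pmull.
have E1 : 1024 ^+ 2 * k ^+ 11 = W.[1] ^+ 2.
  apply/eqP; rewrite -subr_eq0; apply: contraTT dk => nz.
  apply: contraL n33 => /(dvdp_leq nz); rewrite size_polyXn -leqNgt => h.
  apply: (@leq_trans 25) => //; apply: leq_trans (ltnW h) _.
  apply: leq_trans (size_polyD _ _) _; rewrite size_polyN geq_max.
  rewrite -polyC_natr -polyC_exp mul_polyC size_scale ?expf_neq0 //; apply/andP; split.
    by apply: leq_trans (size_poly_exp_leq _ _) _; rewrite size_k.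
  apply: leq_trans (size_poly_exp_leq _ _) _.
  by move: size_W1; move: (size W.[1]) => a; clear; lia.
have kW : k ^+ 5 %| W.[1].
  by rewrite -(@dvdp_pexp2r _ _ _ 2) // -E1 -exprM dvdp_mull // dvdp_exp2l.
case/dvdpP: kW => s Es; have /negP[] := k_not_sqr s.
apply/eqP; apply: (mulIf (expf_neq0 10 k_neq0)).
by rewrite {1}(exprM k 5 2) -exprMn -Es -E1 (exprS k 10) mulrA.
Qed.

Theorem stepanov_point : exists v : F, [/\ v ^+ n = -1, v != -1 & kpoly v ^+ (3 * n) = -1].
Proof.
have [] := @power_roots F n (12 * (3 * n).+1) (-1).
- exact: n_dvd.
- by rewrite exprM -[12%N]/(2 * 6)%N exprM sqrrN !expr1n.
move=> rs [urs srs rs_pow]; pose bad (v : F) := (v == -1) || (kpoly v == 0 :> F).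
pose gs := [seq v <- rs | ~~ bad v].
have sgs : (n <= size gs + 3)%N.
  have : (size [seq v <- rs | bad v] < 4)%N.
    have <- : size (('X + 1%:P) * k) = 4%N.
      by rewrite size_mul ?size_k ?size_XaddC // -size_poly_gt0 size_XaddC.
    apply: max_poly_roots (filter_uniq _ urs).
      by rewrite mulf_neq0 // -size_poly_gt0 size_XaddC.
    apply/allP=> v; rewrite mem_filter rootM => /andP[badv _].
    by rewrite !rootE horner_kpoly hornerD hornerX hornerC addr_eq0.
  by rewrite /gs !size_filter -srs -(count_predC bad rs) (addnC (count bad rs)) leq_add2l.
case: (boolP (has (fun v => kpoly v ^+ (3 * n) == -1) gs)).
  case/hasP=> v; rewrite mem_filter negb_or => /andP[/andP[v1 _] vrs] /eqP kv.
  by exists v; split=> //; apply/eqP/(allP rs_pow).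
move/hasPn=> noroot; exfalso.
(* [v] lies in F_q because v^q = v (v^n)^6, so the power is 1 or -1, and [noroot] excludes -1. *)
have g1 v : v \in gs -> kpoly v ^+ (3 * n) = 1.
  move=> vgs; have := noroot v vgs; move: vgs; rewrite mem_filter negb_or -andbA.
  case/and3P=> _ kv0 /(allP rs_pow)/eqP vn.
  have vq : v ^+ q = v by rewrite qn exprS mulnC exprM vn (exprM _ 2 3) sqrrN !expr1n mulr1.
  have : (kpoly v ^+ (3 * n)) ^+ 2 = 1.
    have kq : kpoly v ^+ q = kpoly v by rewrite kpoly_pchar_exp // vq.
    apply: (mulfI kv0); rewrite mulr1 -exprM -exprS -[RHS]kq qn; congr (_ ^+ _).
    by clear; lia.
  by move/eqP; rewrite sqrf_eq1 => /orP[/eqP// | ->].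
have dvd1 v : v \in gs -> ('X - v%:P) ^+ 7 %| 1024 * k ^+ 6 * g - W.[P].
  move=> vgs; have := g1 v vgs; move: vgs; rewrite mem_filter negb_or -andbA.
  case/and3P=> _ kv0 /(allP rs_pow)/eqP vn gv.
  have Pv : P.[v] = 0 by rewrite /P hornerD hornerXn hornerC vn addNr.
  (* At [v] the second factor takes the value 2 * 1024 * k(v)^6, which is nonzero; all seven factors
     ['X - v] thus divide the first. *)
  rewrite -(@Gauss_dvdpl _ _ (1024 * k ^+ 6 * g + W.[P])).
    apply: dvdp_trans XY_dvd; apply: dvdp_exp2r.
    by rewrite dvdp_XsubCl rootE Pv.
  rewrite coprimep_expl // coprimep_sym coprimep_XsubC rootE hornerD.
  rewrite hornerM (hornerM _ (k ^+ 6)) horner_natr !horner_exp horner_kpoly gv mulr1.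
  have -> : W.[P].[v] = 1024 * kpoly v ^+ 6.
    have : root (W - W.[0]%:P) 0 by rewrite rootE hornerD hornerN hornerC subrr.
    case/factor_theorem => c Ec; have : (W - W.[0]%:P).[P].[v] = 0.
      by rewrite Ec hornerM hornerXsubC subr0 hornerM Pv mulr0.
    rewrite hornerD hornerN hornerC W_at0 hornerD hornerN => /subr0_eq ->.
    by rewrite (hornerM _ (k ^+ 6)) horner_natr horner_exp horner_kpoly.
  rewrite -mulr2n -(mulr_natl (1024 * kpoly v ^+ 6)).
  apply: mulf_neq0 => //; apply: mulf_neq0 => //.
  exact: expf_neq0.
(* Comparing sizes gives 7 (n - 3) + 1 <= 13 + 6 n, that is, n <= 33. *)
have := dvdp_leq X_neq0 (prod_XsubC_exp_dvd (filter_uniq _ urs) dvd1).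
have sX : (size (1024 * k ^+ 6 * g - W.[P])%R <= 13 + 6 * n)%N.
  apply: leq_trans (size_polyD _ _) _; rewrite size_polyN geq_max size_WP andbT.
  rewrite /g -mulrA -exprD -polyC_natr mul_polyC size_scale //.
  by apply: leq_trans (size_poly_exp_leq _ _) _; rewrite size_k; clear; lia.
have := size_prod_XsubC gs id; set Q := \prod_(v <- gs) _ => sQ.
move/leq_trans/(_ sX); have := size_exp Q 7; rewrite sQ.
by move: (size (Q ^+ 7)%R) (size gs) sgs n33 => a b; clear; lia.
Qed.

End Stepanov.

(** * Small fields *)

Section QuadraticResidues.

(* The pair [(a, b)] stands for [a + b s] modulo [p], where [s ^+ 2 = d]. *)
Variables (p d : N).

Definition qmul (x y : N * N) : N * N :=
  (N.modulo (x.1 * y.1 + d * (x.2 * y.2))%num p, N.modulo (x.1 * y.2 + x.2 * y.1)%num p).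

Definition qexp (x : N * N) (n : nat) : N * N := iter n (qmul x) (1%num, 0%num).

Definition qadd (x y : N * N) : N * N := ((x.1 + y.1)%num, (x.2 + y.2)%num).

Definition qkpoly (x : N * N) : N * N :=
  qadd (qadd (qmul x x) (qmul (322%num, 0%num) x)) (1%num, 0%num).

(** That [x] differs from -1 is encoded by the equation (x + 1)^(6n) = 1, since equations between
    pairs carry over to [F] under evaluation. *)
Definition good_residue (n : nat) (x : N * N) : bool :=
  [&& qexp x n == ((p - 1)%num, 0%num),
      qexp (qadd x (1%num, 0%num)) (6 * n) == (1%num, 0%num)
    & qexp (qkpoly x) (3 * n) == ((p - 1)%num, 0%num)].

Variables (F : fieldType) (s : F).
Hypotheses (p_gt0 : (0 < p)%num) (Fp : (N.to_nat p)%:R = 0 :> F) (s2 : s ^+ 2 = (N.to_nat d)%:R).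

Let ev (x : N * N) : F := (N.to_nat x.1)%:R + (N.to_nat x.2)%:R * s.

Let natr_mod (a : N) : (N.to_nat (N.modulo a p))%:R = (N.to_nat a)%:R :> F.
Proof.
have p0 : p <> 0%num by case: (p) p_gt0.
by rewrite [in RHS](N.div_mod a p p0) N2Nat.inj_add N2Nat.inj_mul natrD natrM Fp mul0r add0r.
Qed.

Let ev_mul x y : ev (qmul x y) = ev x * ev y.
Proof.
rewrite /ev /qmul /= !natr_mod !N2Nat.inj_add !N2Nat.inj_mul !natrD !natrM -s2; ring.
Qed.

Let ev_add x y : ev (qadd x y) = ev x + ev y.
Proof. by rewrite /ev /qadd /= !N2Nat.inj_add !natrD; ring. Qed.

Let ev1 : ev (1%num, 0%num) = 1.
Proof. by rewrite /ev /= mul0r addr0. Qed.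

Let ev_exp x n : ev (qexp x n) = ev x ^+ n.
Proof. by elim: n => [|n IH]; rewrite ?ev1 // exprS -IH -ev_mul. Qed.

Let ev_kpoly x : ev (qkpoly x) = kpoly (ev x).
Proof.
rewrite /qkpoly !ev_add !ev_mul ev1 /kpoly expr2.
by rewrite [ev (322%num, _)]/ev /= mul0r addr0.
Qed.

Let evN1 : ev ((p - 1)%num, 0%num) = -1.
Proof.
apply/eqP; rewrite -subr_eq0 opprK -ev1 -ev_add /ev /= mul0r addr0.
by rewrite N.sub_add ?Fp //; move: p_gt0; lia.
Qed.

Lemma good_residue_point n x : (0 < n)%N -> good_residue n x ->
  exists v : F, [/\ v ^+ n = -1, v != -1 & kpoly v ^+ (3 * n) = -1].
Proof.
move=> n0 /and3P[/eqP h1 /eqP h2 /eqP h3]; exists (ev x); split.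
- by rewrite -ev_exp h1 evN1.
- apply/eqP=> E; have := ev_exp (qadd x (1%num, 0%num)) (6 * n).
  rewrite h2 ev_add ev1 E addNr expr0n; case: n n0 {h1 h2 h3} => // n _ /eqP.
  by rewrite oner_eq0.
- by rewrite -ev_kpoly -ev_exp h3 evN1.
Qed.

End QuadraticResidues.

(* [(n, d, (a, b))] stands for the element [a + b * sqrt d] of the field with
   [6 * n + 1] elements; [b] is nonzero only for 49, 121 and 169. *)
Definition small_points : seq (nat * N * (N * N)) := [::
  (2, 1%num, (5%num, 0%num)); (5, 1%num, (15%num, 0%num)); (6, 1%num, (6%num, 0%num));
  (7, 1%num, (8%num, 0%num)); (8, 3%num, (3%num, 1%num)); (10, 1%num, (8%num, 0%num));
  (11, 1%num, (3%num, 0%num)); (12, 1%num, (51%num, 0%num)); (13, 1%num, (12%num, 0%num));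
  (16, 1%num, (19%num, 0%num)); (17, 1%num, (24%num, 0%num)); (18, 1%num, (17%num, 0%num));
  (20, 2%num, (8%num, 1%num)); (21, 1%num, (5%num, 0%num)); (23, 1%num, (27%num, 0%num));
  (25, 1%num, (3%num, 0%num)); (26, 1%num, (2%num, 0%num)); (27, 1%num, (17%num, 0%num));
  (28, 2%num, (6%num, 1%num)); (30, 1%num, (6%num, 0%num)); (32, 1%num, (33%num, 0%num));
  (33, 1%num, (11%num, 0%num))]%N.

(** The clauses before the table discard each [n] for which [6 n + 1] is 7, 19 or not a power of a
    prime above 5, so a single evaluation can run over all [n] up to 33. *)
Definition small_covered (n : nat) : bool :=
  let q := (6 * n).+1 in let p := pdiv q in
  [|| p <= 5, q \in [:: 7; 19], p ^ logn p q != q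
    | has (fun w => (w.1.1 == n) && good_residue (N.of_nat p) w.1.2 n w.2) small_points]%N.

Lemma all_small_covered : all small_covered (iota 1 33).
Proof. by vm_compute. Qed.

Lemma good_point (p m n : nat) (F : finFieldType) :
    prime p -> (5 < p)%N -> (0 < m)%N -> (p ^ m = (6 * n).+1)%N ->
    (p ^ m)%N \notin [:: 7; 19]%N -> #|F| = (p ^ m * p ^ m)%N ->
  exists v : F, [/\ v ^+ n = -1, v != -1 & kpoly v ^+ (3 * n) = -1].
Proof.
move=> p_pr p5 m0 qn q_neq cF.
have chF : p \in [pchar F] by apply: (@card_finPcharP _ _ (m + m)); rewrite // expnD.
have chq : [pchar F].-nat (p ^ m)%N by rewrite (eq_pnat _ (pcharf_eq chF)) pnatX pnat_id.
have n0 : (0 < n)%N.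
  by rewrite lt0n; apply/eqP=> En; have := ltn_exp2l 0 m (prime_gt1 p_pr); rewrite qn En m0.
case: (ltnP 33 n) => n33.
  apply: stepanov_point chq qn cF _ n33; rewrite -(dvdn_pcharf chF).
  by rewrite -[30%N]/(2 * 3 * 5)%N !Euclid_dvdM // !gtnNdvd // (leq_trans _ p5).
have : small_covered n by apply: (allP all_small_covered); rewrite mem_iota n0.
have pd : pdiv (p ^ m) = p by rewrite -(prednK m0) pdiv_pfactor.
rewrite /small_covered -qn pd pfactorK // eqxx leqNgt p5 (negPf q_neq) !orFb.
case/hasP=> -[[n' d] x] _ /andP[/= _ good].
(* A nonzero element of the prime field has (q - 1)-th power 1, and q - 1 = 6 n divides (q^2 - 1) /
   2, so it is a square in [F]. *)
have [s s2] : exists s : F, s ^+ 2 = (N.to_nat d)%:R.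
  have [->|d0] := eqVneq ((N.to_nat d)%:R : F) 0; first by exists 0; rewrite expr0n.
  have dd : (2 * (6 * n * (3 * n).+1))%N = #|F|.-1 by rewrite cF qn; clear; lia.
  apply: power_root dd _; rewrite exprM.
  have -> : (N.to_nat d)%:R ^+ (6 * n) = 1 :> F; last exact: expr1n.
  by apply: (mulfI d0); rewrite mulr1 -exprS -qn natr_pchar_exp.
apply: (@good_residue_point (N.of_nat p) d F s _ _ s2 n x n0 good).
- by move: p5; clear; lia.
- by rewrite Nat2N.id; apply: pcharf0.
Qed.

Lemma card_le_Poly (F : finFieldType) (A : {set F}) (h : F -> F) (s : seq F) :
    last 0 s != 0 -> {in A &, injective h} ->
    (forall w, w \in A -> (Poly s).[h w] = 0) ->
  (#|A| < size s)%N.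
Proof.
move=> s0 hinj hroot; have ss : size (Poly s) = size s by rewrite (PolyK s0).
rewrite -(card_in_imset hinj) -ss cardE; apply: max_poly_roots (enum_uniq _).
  by rewrite -size_poly_gt0 ss; case: (s) s0; rewrite ?eqxx.
by apply/allP=> _ /[!mem_enum] /imsetP[w wA ->]; rewrite rootE hroot.
Qed.

(** * The boomerang equation *)

Section Boomerang.

Variables (F : finFieldType) (q : nat).
Hypotheses (chq : [pchar F].-nat q) (cF : #|F| = (q * q)%N).
Hypothesis F2 : (2 : F) != 0.

Let qD (x y : F) : (x + y) ^+ q = x ^+ q + y ^+ q.
Proof. exact: exprDn_pchar. Qed.

Let qN (x : F) : (- x) ^+ q = - x ^+ q.
Proof. exact: exprNn_pchar. Qed.

Let qn (m : nat) : (m%:R : F) ^+ q = m%:R.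
Proof. exact: natr_pchar_exp. Qed.

Let qK (x : F) : (x ^+ q) ^+ q = x.
Proof. by rewrite -exprM -cF expf_card. Qed.

Definition boomerang_eq (w : F) : F := w ^+ 2 * w ^+ q + 2 * w + w ^+ q.

Lemma boomerang_eq_card (c : F) : (#|[set w | boomerang_eq w == c]| <= 5)%N.
Proof.
have F4 : (4 : F) != 0 by rewrite (natrX _ 2 2) expf_neq0.
have wE w : boomerang_eq w = c -> w ^+ 2 * w ^+ q + 2 * w + w ^+ q = c /\
    (w ^+ q) ^+ 2 * w + 2 * w ^+ q + w = c ^+ q.
  by move=> <-; rewrite /boomerang_eq !qD (exprMn q (w ^+ 2)) (exprMn q 2) (qn 2) exprAC qK.
have [c0|C0] := eqVneq (c + c ^+ q) 0.
  have cq : c ^+ q = - c by apply/eqP; rewrite -addr_eq0 addrC c0.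
  (* Coefficients of (w^2 + c w + 3)(w^3 - w + c): the cubic comes from w' = -w, the quadratic from
     N = -3, which forces w' = w + c. *)
  rewrite -ltnS; apply: (@card_le_Poly _ _ id [:: 3 * c; c ^+ 2 - 3; 0; 2; c; 1]) => //=.
    exact: oner_neq0.
  move=> w; rewrite inE => /eqP/wE; rewrite cq; move: (w ^+ q) => v [E1 E2].
  have : (w + v) * (w * v + 3) = 0.
    transitivity ((w ^+ 2 * v + 2 * w + v) + (v ^+ 2 * w + 2 * v + w)); first by ring.
    by rewrite E1 E2 subrr.
  move/eqP; rewrite mulf_eq0 => /orP[/eqP r0 | /eqP N3].
    have Ev : v = - w by apply/eqP; rewrite -addr_eq0 addrC r0.
    rewrite /= !horner_cons horner0 -E1 Ev; ring.
  have Ev : v = w + c.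
    rewrite -E1 -[RHS]subr0 -[in RHS](mul0r w) -N3; ring.
  rewrite /= !horner_cons horner0; move: N3; rewrite Ev => N3.
  transitivity ((w * (w + c) + 3) * (w ^+ 3 - w + c)); first by ring.
  by rewrite N3 mul0r.
have [c0|C1] := eqVneq (c - c ^+ q) 0.
  have cq : c ^+ q = c by apply/esym/subr0_eq.
  (* Coefficients of (w^2 - c w - 1)(w^3 + 3 w - c): here w' = w, or N = -1 and w' = c - w. *)
  rewrite -ltnS; apply: (@card_le_Poly _ _ id [:: c; c ^+ 2 - 3; - (4 * c); 2; - c; 1]) => //=.
    exact: oner_neq0.
  move=> w; rewrite inE => /eqP/wE; rewrite cq; move: (w ^+ q) => v [E1 E2].
  have : (w - v) * (w * v + 1) = 0.
    transitivity ((w ^+ 2 * v + 2 * w + v) - (v ^+ 2 * w + 2 * v + w)); first by ring.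
    by rewrite E1 E2 subrr.
  move/eqP; rewrite mulf_eq0 => /orP[/eqP/subr0_eq Ev | /eqP N1].
    rewrite /= !horner_cons horner0 -E1 -Ev; ring.
  have Ev : v = c - w.
    rewrite -E1 -[RHS]subr0 -[in RHS](mul0r w) -N1; ring.
  rewrite /= !horner_cons horner0; move: N1; rewrite Ev => N1.
  transitivity (- ((w * (c - w) + 1) * (w ^+ 3 + 3 * w - c))); first by ring.
  by rewrite N1 mul0r oppr0.
have NE w : boomerang_eq w = c -> let N := w * w ^+ q in
    (w + w ^+ q) * (N + 3) = c + c ^+ q /\ (w - w ^+ q) * (N + 1) = c - c ^+ q.
  by move=> /wE[E1 E2]; split; rewrite -E2 -E1; ring.
pose C := c + c ^+ q; pose D := c - c ^+ q.
(* The quintic 4 N (N + 1)^2 (N + 3)^2 - C^2 (N + 1)^2 + D^2 (N + 3)^2, obtained from (w + w')^2 -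
   (w - w')^2 = 4 N. *)
rewrite -ltnS; apply: (@card_le_Poly _ _ (fun w => w * w ^+ q)
  [:: 9 * D ^+ 2 - C ^+ 2; 36 - 2 * C ^+ 2 + 6 * D ^+ 2; 96 - C ^+ 2 + D ^+ 2; 88; 32; 4]) => //=.
  move=> w w'; rewrite !inE => /eqP/NE[E1 E2] /eqP/NE[E1' E2'] EN.
  rewrite -EN in E1' E2'.
  have nz (t x y : F) : t != 0 -> x * y = t -> y != 0.
    by move=> t0 Et; apply: contraNneq t0 => y0; rewrite -Et y0 mulr0.
  have Er := mulIf (nz _ _ _ C0 E1) (etrans E1 (esym E1')).
  have Es := mulIf (nz _ _ _ C1 E2) (etrans E2 (esym E2')).
  apply: (mulfI F2); transitivity ((w + w ^+ q) + (w - w ^+ q)); first by ring.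
  by rewrite Er Es; ring.
move=> w; rewrite inE => /eqP/NE[]; rewrite -/C -/D => <- <-.
rewrite /= !horner_cons horner0; move: (w ^+ q) => v; ring.
Qed.

Section Apn.
Variable th : F.
Hypotheses (th2 : th ^+ 2 = -3) (thq : th ^+ q = th) (F3 : (3 : F) != 0).

(** The additive map [L] has trivial kernel, and th^2 = -3 makes [L x ^+ 2] a function of [M x]
    alone; so [L u] and [L v] agree up to sign. *)
Lemma quadratic_twist_inj (u v : F) :
  u ^+ 2 + 2 * u * u ^+ q = v ^+ 2 + 2 * v * v ^+ q -> v = u \/ v = - u.
Proof.
have th0 : th != 0 by rewrite -sqrf_eq0 th2 oppr_eq0.
pose L x := th * (x + x ^+ q) + (x - x ^+ q).
have LD x y : L (x + y) = L x + L y by rewrite /L qD; ring.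
have LN x : L (- x) = - L x by rewrite /L qN; ring.
have L0 x : L x = 0 -> x = 0.
  rewrite /L => Lx; have := congr1 (fun t => t ^+ q) Lx.
  have q0 : (q == 0)%N = false by case: (q) chq.
  rewrite !qD qN exprMn thq !qD qK expr0n q0 /=; move: Lx; move: (x ^+ q) => y E1 E2.
  have s0 : x - y = 0.
    apply: (mulfI F2); transitivity (th * (x + y) + (x - y) - (th * (y + x) + (y - x))).
      by ring.
    by rewrite E1 E2 mulr0 subrr.
  move: E1; rewrite s0 addr0 => /eqP; rewrite mulf_eq0 (negPf th0) /=.
  by rewrite -(subr0_eq s0) -mulr2n -(mulr_natl x) mulf_eq0 (negPf F2) => /eqP.
pose M (x : F) := x ^+ 2 + 2 * x * x ^+ q.
have L2 x : L x ^+ 2 = 2 * th * (M x - M x ^+ q) - 2 * (M x + M x ^+ q).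
  have -> : M x ^+ q = (x ^+ q) ^+ 2 + 2 * x ^+ q * x.
    by rewrite /M qD (exprMn q (2 * x)) (exprMn q 2) (qn 2) exprAC qK.
  rewrite /L /M; move: (x ^+ q) => y.
  transitivity (th ^+ 2 * (x + y) ^+ 2 + (x - y) ^+ 2 + 2 * th * (x ^+ 2 - y ^+ 2)); first by ring.
  by rewrite th2; ring.
rewrite -/(M u) -/(M v) => EM; have := L2 u; rewrite EM -L2 => /eqP; rewrite eqf_sqr.
case/orP=> /eqP E; [left|right]; apply: subr0_eq; apply: L0.
  by rewrite LD LN E subrr.
by rewrite opprK LD E addrC addNr.
Qed.

Lemma boomerang_count_cube (a b : F) : a != 0 -> b != 0 ->
  boomerang_count (fun x => x ^+ (q + 2)) a b
    = #|[set w | boomerang_eq w == 4 * b / a ^+ (q + 2)]|.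
Proof.
move=> a0 b0; pose fA (w : F) := (a * (w - 1) / 2, - (a * (w + 1) / 2)).
have aq0 : a ^+ q != 0 by rewrite expf_neq0.
have F4 : (4 : F) != 0 by rewrite (natrX _ 2 2) expf_neq0.
have F8 : (8 : F) != 0 by rewrite (natrX _ 2 3) expf_neq0.
pose A := a ^+ (q + 2); have A0 : A != 0 by rewrite expf_neq0.
have q1 : 1 ^+ q = 1 :> F := expr1n _ _.
have fE w : (a * w / 2) ^+ (q + 2) = a ^+ (q + 2) * (w ^+ q * w ^+ 2) / 8.
  rewrite (exprMn _ (a * w)) (exprMn _ a w) exprVn (exprD w) (exprD 2) (qn 2).
  by congr (_ / _); ring.
have fN (x : F) : (- x) ^+ (q + 2) = - x ^+ (q + 2).
  by rewrite exprD qN sqrrN mulNr -exprD.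
rewrite -(@card_imset _ _ fA); last first.
  move=> w w' [/(mulIf (invr_neq0 F2))/(mulfI a0)/addIr //].
rewrite /boomerang_count; apply: eq_card => -[x y]; rewrite !inE /=.
apply/andP/imsetP => [[/eqP E1 /eqP E2]|[w]]; last first.
  rewrite inE /boomerang_eq => /eqP Ew [-> ->].
  have Eb : b = A * (w ^+ 2 * w ^+ q + 2 * w + w ^+ q) / 4.
    by rewrite Ew -/A; field; rewrite ?F2 ?F4 ?A0.
  have -> : a * (w - 1) / 2 + a = a * (w + 1) / 2 by field.
  have -> : - (a * (w + 1) / 2) + a = - (a * (w - 1) / 2) by field.
  rewrite !fN !opprK !fE !qD qN q1; split; apply/eqP.
    by rewrite Eb -/A; field; rewrite F4 F8.
  by rewrite Eb -/A; field; rewrite F4 F8.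
(* In this centred variable f(x + a) - f(x) = A/4 (w^2 + 2 w w^q + 1). The increments at [x] and [y]
   agree, so [w'] is [w] or [- w], and [w' = w] would give [b = 0]. *)
pose w := 2 * x / a + 1; pose w' := 2 * y / a + 1.
have Ex : x = a * (w - 1) / 2 by rewrite /w; field; rewrite F2 a0.
have Ey : y = a * (w' - 1) / 2 by rewrite /w'; field; rewrite F2 a0.
have Exa : x + a = a * (w + 1) / 2 by rewrite /w; field; rewrite F2 a0.
have Eya : y + a = a * (w' + 1) / 2 by rewrite /w'; field; rewrite F2 a0.
clearbody w w'; move: E1 E2; rewrite Exa Eya Ex Ey !fE !qD !qN q1 => E1 E2.
have [] := @quadratic_twist_inj w w'.
- apply: (mulfI (mulf_neq0 A0 (invr_neq0 F4))); apply: subr0_eq.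
  by rewrite -[RHS](subrr b) -{1}E2 -E1 -/A; field; rewrite F4 F8.
- by move=> Ew; case/eqP: b0; rewrite -E1 Ew subrr.
move=> Ew; exists w; last by rewrite /fA Ew; congr (_, _); field.
rewrite inE /boomerang_eq -E1 Ew qN -/A; apply/eqP; field.
by rewrite F8 A0.
Qed.

End Apn.

End Boomerang.

Lemma cube_root_of_unity (F : finFieldType) (e : nat) :
  (3 * e)%N = #|F|.-1 -> exists w : F, w ^+ 2 + w + 1 = 0.
Proof.
move=> de; have [rs [urs srs /allP rs3]] := power_roots de (expr1n F e).
have [w wrs w1] : exists2 w, w \in rs & w != 1.
  case: rs urs srs rs3 => [|x [|y rs]] //= /andP[xrs _] _ _.
  have [Ex|x1] := eqVneq x 1; last by exists x; rewrite ?mem_head.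
  exists y; first by rewrite !inE eqxx orbT.
  by apply: contraNneq xrs => ->; rewrite Ex mem_head.
exists w; apply: (mulfI (_ : w - 1 != 0)); first by rewrite subr_eq0.
rewrite mulr0; transitivity (w ^+ 3 - 1); first by ring.
by rewrite (eqP (rs3 w wrs)) subrr.
Qed.

(** * Five explicit solutions *)

Section FiveSolutions.

Variables (F : finFieldType) (q : nat).
Hypotheses (chq : [pchar F].-nat q) (F2 : (2 : F) != 0) (F3 : (3 : F) != 0).
Variables (w z y : F).
Hypotheses (w2 : w ^+ 2 + w + 1 = 0) (wq : w ^+ q = w).
Hypotheses (z0 : z != 0) (zq : z ^+ q = - z) (z6 : z ^+ 6 != 1) (z6' : z ^+ 6 != -1).
Hypotheses (y0 : y != 0) (yq : y ^+ q = y) (y2 : y ^+ 2 = z ^+ 2 * kpoly (z ^+ 6)).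

Let th : F := 2 * w + 1.
Let th2 : th ^+ 2 = -3.
Proof.
transitivity (4 * (w ^+ 2 + w + 1) - 3); first by rewrite /th; ring.
by rewrite w2; ring.
Qed.

Let th0 : th != 0.
Proof. by rewrite -sqrf_eq0 th2 oppr_eq0. Qed.

Let qD (x t : F) : (x + t) ^+ q = x ^+ q + t ^+ q.
Proof. exact: exprDn_pchar. Qed.

Let qN (x : F) : (- x) ^+ q = - x ^+ q.
Proof. exact: exprNn_pchar. Qed.

Let thq : th ^+ q = th.
Proof. by rewrite /th qD exprMn natr_pchar_exp // wq expr1n. Qed.

(** Cardano's substitution: as th^2 = -3, t = [s x] satisfies t - t^3 = (x^3 - x^-3) / (3 th), so
    each cube root [x] of [z ^+ 3] gives a root of t - t^3 = c. *)
Let s (x : F) : F := (x - x^-1) / th.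
Let c : F := (z ^+ 3 - (z ^+ 3)^-1) / (3 * th).
Let rho : F := th * y / (18 * z ^+ 4).

Let F18 : (18 : F) != 0.
Proof. by rewrite (natrM _ 2 9) mulf_neq0 // (natrX _ 3 2) expf_neq0. Qed.

Let rho0 : rho != 0.
Proof. by rewrite /rho mulf_neq0 ?mulf_neq0 // invr_neq0 // mulf_neq0 // expf_neq0. Qed.

Let rhoq : rho ^+ q = rho.
Proof.
rewrite /rho exprMn exprMn exprVn (exprMn _ 18) natr_pchar_exp // thq yq.
by rewrite exprAC zq -[4%N]/(2 * 2)%N !exprM sqrrN.
Qed.

Let cq : c ^+ q = - c.
Proof.
rewrite /c exprMn exprVn (exprMn _ 3) natr_pchar_exp // thq qD qN exprVn exprAC zq.
by rewrite exprNn -signr_odd mulN1r invrN -opprD mulNr.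
Qed.

Let rho2 : rho ^+ 2 = c ^+ 2 / 4 - 3.
Proof.
have -> : c ^+ 2 = (z ^+ 3 - (z ^+ 3)^-1) ^+ 2 / (3 ^+ 2 * th ^+ 2) by rewrite -exprMn -expr_div_n.
have -> : rho ^+ 2 = th ^+ 2 * y ^+ 2 / (18 ^+ 2 * z ^+ 8).
  by rewrite /rho expr_div_n (exprMn 2 th) (exprMn 2 18) -exprM.
rewrite th2 y2 /kpoly; field.
have F27 : (27 : F) != 0 by rewrite (natrX _ 3 3) expf_neq0.
have F324 : (324 : F) != 0 by rewrite (natrX _ 18 2) expf_neq0.
by rewrite (natrX _ 2 2) expf_neq0 // oppr_eq0 F27 z0 F324.
Qed.

Let sq x : x != 0 -> x ^+ q = - x -> s x ^+ q = - s x.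
Proof. by move=> x0 xq; rewrite /s exprMn exprVn thq qD qN exprVn xq invrN -opprD mulNr. Qed.

Let s_sol x : x != 0 -> x ^+ q = - x -> x ^+ 3 = z ^+ 3 -> boomerang_eq q (s x) = c.
Proof.
move=> x0 xq x3; rewrite /boomerang_eq sq // /c -x3.
have s2 : s x ^+ 2 = (x - x^-1) ^+ 2 / -3 by rewrite /s expr_div_n th2.
rewrite s2 /s; field.
by rewrite oppr_eq0 F3 th0 x0.
Qed.

(** With [e] a sign, w = -c/2 + e rho has conjugate w' = c/2 + e rho, so w w' = rho^2 - c^2/4 = -3
    and the equation becomes w' - w = c. *)
Let r_sol e : e ^+ 2 = 1 -> e ^+ q = e -> boomerang_eq q (- c / 2 + e * rho) = c.
Proof.
move=> e2 eq; have F4 : (4 : F) != 0 by rewrite (natrX _ 2 2) expf_neq0.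
have -> : boomerang_eq q (- c / 2 + e * rho) =
   (- c / 2 + e * rho) * (e ^+ 2 * rho ^+ 2 - c ^+ 2 / 4 + 2) + (c / 2 + e * rho).
  rewrite /boomerang_eq qD (exprMn q e) eq rhoq (exprMn q (- c)) qN cq exprVn natr_pchar_exp //.
  by field; rewrite ?F2 ?F4.
by rewrite e2 rho2; field; rewrite ?F2 ?F4.
Qed.

(** Clearing denominators in [s x = s x'] gives (x - x')(x x' + 1) = 0, and x x' = -1 would force
    z^6 = -1. *)
Let s_inj x x' : x != 0 -> x' != 0 -> (x * x') ^+ 3 = z ^+ 6 -> s x = s x' -> x = x'.
Proof.
move=> x0 x0' xx /(mulIf (invr_neq0 th0)) E; apply: subr0_eq.
have xx0 : x * x' + 1 != 0.
  apply: contraNneq z6' => /eqP; rewrite addr_eq0 => /eqP E'.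
  by rewrite -xx E'; apply/eqP; ring.
apply: (mulIf xx0); rewrite mul0r.
transitivity (x * x' * ((x - x^-1) - (x' - x'^-1))); first by field; rewrite x0 x0'.
by rewrite E subrr mulr0.
Qed.

Lemma five_solutions : exists2 c : F, c != 0 & (5 <= #|[set x | boomerang_eq q x == c]|)%N.
Proof.
exists c.
  rewrite /c mulf_neq0 ?invr_neq0 ?mulf_neq0 // subr_eq0.
  apply: contraNneq z6 => E; rewrite (exprM z 3 2) expr2 {1}E mulVf // expf_neq0 //.
have w3 : w ^+ 3 = 1.
  by apply: subr0_eq; transitivity ((w - 1) * (w ^+ 2 + w + 1)); [ring | rewrite w2 mulr0].
have w0 : w != 0 by apply: contraTneq (oner_neq0 F) => w0; rewrite -w3 w0 expr0n eqxx.
have w1 : w != 1.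
  by apply: contraNneq F3 => w1; rewrite -w2 w1; apply/eqP; ring.
pose xs := [:: z; w * z; w ^+ 2 * z].
have xsP x : x \in xs -> [/\ x != 0, x ^+ q = - x & x ^+ 3 = z ^+ 3].
  rewrite !inE => /or3P[] /eqP->.
  - by [].
  - by rewrite mulf_neq0 // !exprMn wq zq w3 mul1r mulrN.
  - by rewrite mulf_neq0 ?expf_neq0 // exprMn (exprMn 3) exprAC wq zq exprAC w3 expr1n mul1r mulrN.
pose rs := [:: - c / 2 + 1 * rho; - c / 2 + -1 * rho].
have uxs : uniq (map s xs).
  rewrite map_inj_in_uniq; last first.
    move=> x x' /xsP[x0 _ x3] /xsP[x0' _ x3']; apply: s_inj => //.
    by rewrite exprMn x3 x3' -exprD.
  have nz a b : b != a -> a * z != b * z by move=> ab; rewrite (inj_eq (mulIf z0)) eq_sym.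
  rewrite /= !inE negb_or andbT -[X in (X != w * z) && (X != _)]mul1r !nz //.
    by rewrite expr2 -[X in _ != X]mulr1 (inj_eq (mulfI w0)).
  by apply: contraNneq w1 => w21; rewrite -w3 exprS w21 mulr1.
pose sols := map s xs ++ rs.
have -> : 5%N = size sols by [].
rewrite cardE; apply: uniq_leq_size.
  rewrite cat_uniq uxs andTb; apply/andP; split.
    (* The two families are disjoint: t + t^q is 0 on the first and 2 rho or -2 rho on the
       second. *)
    apply/hasPn => t trs; apply/mapP=> -[x /xsP[x0 xq _] Et].
    have : t + t ^+ q = 0 by rewrite Et sq // subrr.
    have [e e1 ->] : exists2 e, e != 0 & t + t ^+ q = 2 * (e * rho).
      have cV : (- c / 2) ^+ q = c / 2.
        by rewrite (exprMn q (- c)) qN cq exprVn natr_pchar_exp // opprK.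
      move: trs; rewrite !inE => /orP[] /eqP->; rewrite qD cV.
        by exists 1; rewrite ?oner_neq0 // !mul1r rhoq; field.
      by exists (-1); rewrite ?oppr_eq0 ?oner_neq0 // !mulN1r qN rhoq; field.
    by apply/eqP; rewrite mulf_neq0 ?(mulf_neq0 e1).
  rewrite /= inE andbT (inj_eq (addrI _)) mul1r mulN1r -subr_eq0 opprK -mulr2n -mulr_natl.
  by rewrite mulf_neq0.
move=> x; rewrite /sols mem_cat mem_enum in_set => /orP[/mapP[t /xsP[t0 tq t3] ->]|].
  by rewrite s_sol.
rewrite !inE => /orP[] /eqP ->; rewrite r_sol ?eqxx ?expr1n ?sqrrN ?expr1n //.
by rewrite qN expr1n.
Qed.

End FiveSolutions.

(* The boomerang uniformity of x^(q+2) *)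
Local Close Scope ring_scope.

(* F is any finite field with q^2 elements, q = p^m (i.e. F = F_{q^2}). *)
Theorem theorem7 (p m : nat) (F : finFieldType) :
  prime p -> 5 < p -> 0 < m ->
  p ^ m %% 6 = 1 ->
  p ^ m \notin [:: 7; 19; 313] ->
  #|F| = p ^ m * p ^ m ->
  boomerang_uniformity (fun x : F => (x ^+ (p ^ m + 2))%R) = 5.
Proof.
move=> p_pr p5 m0 q6 q_neq cF.
set n := (p ^ m %/ 6)%N; have qn : p ^ m = (6 * n).+1 by rewrite {1}(divn_eq (p ^ m) 6) q6 -/n; lia.
clearbody n; have n0 : 0 < n.
  have : 5 < p ^ m := leq_trans p5 (leq_pexp2l (prime_gt0 p_pr) m0).
  by rewrite qn; case: (n).
have chF : p \in [pchar F]%R by apply: (@card_finPcharP _ _ (m + m)); rewrite // expnD.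
have chq : [pchar F]%R.-nat (p ^ m) by rewrite (eq_pnat _ (pcharf_eq chF)) pnatX pnat_id.
have F2 : (2 : F)%R != 0%R by rewrite -(dvdn_pcharf chF) gtnNdvd // (leq_trans _ p5).
have F3 : (3 : F)%R != 0%R by rewrite -(dvdn_pcharf chF) gtnNdvd // (leq_trans _ p5).
have N1 : #|F|.-1 = (12 * n * (3 * n).+1)%N by rewrite cF qn; clear; lia.
have q_neq' : p ^ m \notin [:: 7; 19].
  by apply: contra q_neq; rewrite !inE => /orP[] ->; rewrite ?orbT.
(* A primitive cube root of unity; it lies in F_q as 3 divides q - 1, and [2 * w + 1] is the square
   root of -3 needed there. *)
have [w w2] : exists w : F, (w ^+ 2 + w + 1 = 0)%R.
  by apply: (@cube_root_of_unity _ (4 * n * (3 * n).+1)); rewrite N1; clear; lia.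
have w3 : (w ^+ 3 = 1)%R.
  apply: subr0_eq; transitivity ((w - 1) * (w ^+ 2 + w + 1))%R; first by ring.
  by rewrite w2 mulr0.
have wq : (w ^+ (p ^ m) = w)%R.
  by rewrite qn exprS -[6]/(3 * 2) -mulnA exprM w3 expr1n mulr1.
have th2 : ((2 * w + 1) ^+ 2 = -3 :> F)%R.
  transitivity (4 * (w ^+ 2 + w + 1) - 3 : F)%R; first by ring.
  by rewrite w2 mulr0 add0r.
have thq : ((2 * w + 1) ^+ (p ^ m) = 2 * w + 1 :> F)%R.
  by rewrite exprDn_pchar // exprMn natr_pchar_exp // wq expr1n.
have card_sol a b := @boomerang_count_cube F (p ^ m) chq cF F2 _ th2 thq F3 a b.
apply/eqP; rewrite eqn_leq; apply/andP; split.
  apply/bigmax_leqP=> -[a b] /= /andP[a0 b0]; rewrite card_sol //.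
  exact: boomerang_eq_card.
have [v [vn v1 kv]] := good_point p_pr p5 m0 qn q_neq' cF.
(* Both [T] and [kpoly v] have (q - 1)/2-th power -1, so they are nonsquares of F_q. Hence a square
   root [z] of [T] satisfies z^q = -z, while a square root [y] of their product lies in F_q;
   moreover z^6 = v. *)
have [T T3] : exists T : F, (T ^+ 3 = v)%R.
  apply: (@power_root _ _ (n * (4 * (3 * n).+1))); first by rewrite N1; clear; lia.
  by rewrite exprM vn exprM -signr_odd !expr1n.
have Tn : (T ^+ (3 * n) = -1)%R by rewrite exprM T3.
have [z z2] : exists z : F, (z ^+ 2 = T)%R.
  apply: (@power_root _ _ (3 * n * (2 * (3 * n).+1))); first by rewrite N1; clear; lia.
  by rewrite exprM Tn exprM sqrrN !expr1n.
have [y y2] : exists y : F, (y ^+ 2 = T * kpoly v)%R.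
  apply: (@power_root _ _ (3 * n * (2 * (3 * n).+1))); first by rewrite N1; clear; lia.
  by rewrite exprM exprMn Tn kv mulrNN mulr1 expr1n.
have qn2 : p ^ m = (2 * (3 * n)).+1 by rewrite qn mulnA.
have nz (x : F) : (x ^+ (3 * n) = -1 -> x != 0)%R.
  move=> E; apply/eqP=> x0; have /eqP := E.
  by rewrite x0 expr0n muln_eq0 (gtn_eqF n0) eq_sym oppr_eq0 oner_eq0.
have z6 : (z ^+ 6 = v)%R by rewrite (exprM z 2 3) z2.
have [c c0 sol5] : exists2 c : F, (c != 0)%R & 5 <= #|[set x | boomerang_eq (p ^ m) x == c]|.
  apply: (@five_solutions F (p ^ m) chq F2 F3 w z y) => //.
  - by rewrite -sqrf_eq0 z2 nz.
  - by rewrite qn2 exprS exprM z2 Tn mulrN1.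
  - rewrite z6; apply: contraNneq F2 => v_1; move: vn; rewrite v_1 expr1n => /eqP.
    by rewrite -addr_eq0.
  - by rewrite z6.
  - by rewrite -sqrf_eq0 y2 mulf_neq0 ?nz.
  - by rewrite qn2 exprS exprM y2 exprMn Tn kv mulrNN !mulr1.
  - by rewrite z6 z2.
apply: leq_trans sol5 _.
have F4 : (4 : F)%R != 0%R by rewrite (natrX _ 2 2) expf_neq0.
have b0 : (c / 4 != 0)%R by rewrite mulf_neq0 // invr_neq0.
(* At a = 1, b = c / 4 the right-hand side 4 b / f(a) is [c]. *)
apply: leq_trans (leq_bigmax_cond (1, c / 4)%R _); last by rewrite /= oner_neq0 b0.
rewrite /= card_sol ?oner_neq0 // expr1n divr1 mulrC divfK //.
Qed.
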